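(* Let $n\ge 4$. Among all strongly connected digraphs of order $n$, up to isomorphism, $\theta(0,1,n-3)$, $\theta(1,1,n-4)$ and $\theta(0,2,n-4)$ are the unique digraphs achieving the second, the third and the fourth minimum spectral radius, respectively.
   Context: Digraphs have no loops and no multiple arcs (arcs $uv$ and $vu$ may both be present). The spectral radius $\rho(D)$ of a digraph $D$ is the largest modulus of an eigenvalue of its adjacency matrix. A digraph is strongly connected if for every ordered pair of vertices there is a directed path from the first to the second. (The directed cycle $C_n$ is the unique strongly connected digraph of order $n$ with minimum spectral radius.) Let $P_m$ denote a directed path on $m$ vertices. For integers $0\le a\le b$, $c\ge 0$, the $\theta$-digraph $\theta(a,b,c)$ consists of three internally vertex-disjoint directed paths $P_{a+2}$, $P_{b+2}$, $P_{c+2}$ such that $P_{a+2}$ and $P_{b+2}$ both start at the terminal vertex of $P_{c+2}$ and both end at the initial vertex of $P_{c+2}$; it has order $a+b+c+2$. *)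

(* Defs.v *)
From HB Require Import structures.
From mathcomp Require Import all_boot all_order all_algebra all_field.

Set Implicit Arguments.
Unset Strict Implicit.
Unset Printing Implicit Defensive.

Import Order.TTheory GRing.Theory Num.Theory.
Local Open Scope ring_scope.

Record digraph := Digraph {
  vertex :> finType;
  darc : rel vertex;
  darc_irr : irreflexive darc
}.

Definition digraph_order (D : digraph) : nat := #|D|.

Definition strongly_connected (D : digraph) : Prop :=
  forall x y : D, connect (@darc D) x y.

Definition isomorphic (D E : digraph) : Prop :=
  exists2 f : D -> E, bijective f & forall x y, darc (f x) (f y) = darc x y.

Definition adjacency (D : digraph) : 'M[algC]_(digraph_order D) :=
  \matrix_(i, j) (darc (enum_val i : D) (enum_val j))%:R.

(* The complex eigenvalues, with algebraic multiplicity. Adjacency matrices    *)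
(* have integer entries, so all their complex eigenvalues lie in algC.         *)
Definition spectrum (n : nat) (A : 'M[algC]_n) : seq algC :=
  sval (closed_field_poly_normal (char_poly A)).

Lemma mem_spectrum (n : nat) (A : 'M[algC]_n) (z : algC) :
  (z \in spectrum A) = eigenvalue A z.
Proof.
rewrite eigenvalue_root_char /spectrum.
case: closed_field_poly_normal => s /= ->.
by rewrite (monicP (char_poly_monic A)) scale1r root_prod_XsubC.
Qed.

Definition spectral_radius (D : digraph) : algC :=
  \big[Num.max/0]_(z <- spectrum (adjacency D)) `|z|.

Lemma spectral_radius_ge (D : digraph) (z : algC) :
  eigenvalue (adjacency D) z -> `|z| <= spectral_radius D.
Proof.
rewrite -mem_spectrum /spectral_radius; elim: (spectrum _) => // x s IHs.
have ge0 : 0 <= \big[Num.max/0]_(z <- s) `|z|.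
  elim/big_ind: _ => // u v u0 v0; by rewrite /Order.max; case: ifP.
have cmp : `|x| >=< \big[Num.max/0]_(z <- s) `|z|.
  by apply: real_comparable; apply: ger0_real.
rewrite inE big_cons comparable_le_max //.
by case/predU1P=> [->|/IHs ->]; rewrite ?lexx ?orbT.
Qed.

Lemma spectral_radius_attained (D : digraph) : (0 < digraph_order D)%N ->
  exists2 z, eigenvalue (adjacency D) z & `|z| = spectral_radius D.
Proof.
move=> D0; have : spectrum (adjacency D) != [::].
  apply: contraTneq D0 => s0; rewrite -eqn0Ngt -eqSS -(size_char_poly (adjacency D)).
  move: s0; rewrite /spectrum; case: closed_field_poly_normal => s /= -> ->.
  by rewrite big_nil (monicP (char_poly_monic _)) scale1r size_poly1.
suff: spectrum (adjacency D) != [::] ->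
    exists2 z, z \in spectrum (adjacency D) & `|z| = spectral_radius D.
  by move=> H /H[z]; rewrite mem_spectrum; exists z.
rewrite /spectral_radius; elim: (spectrum _) => // x [|y s] IHs _.
  exists x; rewrite ?mem_head // big_cons big_nil /Order.max.
  by rewrite (le_gtF (normr_ge0 x)).
have [//|z zs zE] := IHs _; rewrite big_cons -zE /Order.max.
case: ifP => _; last by exists x => //; rewrite mem_head.
by exists z => //; rewrite inE zs orbT.
Qed.

(* S has exactly k - 1 (distinct) elements smaller than its element r.         *)
Definition kth_min (S : algC -> Prop) (k : nat) (r : algC) : Prop :=
  S r /\ exists l : seq algC,
    [/\ uniq l, (size l).+1 = k & forall s, s \in l <-> S s /\ s < r].

Definition strong_spectral_radii (n : nat) (r : algC) : Prop :=
  exists D : digraph,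
    [/\ digraph_order D = n, strongly_connected D & spectral_radius D = r].

Definition unique_kth_min_digraph (n k : nat) (D : digraph) : Prop :=
  [/\ digraph_order D = n, strongly_connected D,
      kth_min (strong_spectral_radii n) k (spectral_radius D)
    & forall E : digraph, digraph_order E = n -> strongly_connected E ->
        kth_min (strong_spectral_radii n) k (spectral_radius E) ->
        isomorphic E D].

Definition consecutive (T : eqType) (p : seq T) : rel T :=
  fun x y => (x, y) \in zip p (behead p).

Lemma consecutive_irr (T : eqType) (p : seq T) :
  uniq p -> irreflexive (consecutive p).
Proof.
move=> Up x; apply/negP; elim: p Up => // y [//|z p] IHp /andP[yNp Up].
rewrite /consecutive /= inE => /orP[/eqP[xy xz]|]; last exact: IHp.
by rewrite -xy xz mem_head in yNp.
Qed.

Section Theta.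
Variables a b c : nat.

Definition theta_vertex : Type := (bool + ('I_a + 'I_b + 'I_c))%type.

HB.instance Definition _ := Finite.on theta_vertex.

(* The initial and the terminal vertex of the path with c internal vertices.   *)
Definition theta_init : theta_vertex := inl false.
Definition theta_term : theta_vertex := inl true.

Definition theta_path_a : seq theta_vertex :=
  theta_term :: rcons [seq inr (inl (inl i)) | i <- enum 'I_a] theta_init.
Definition theta_path_b : seq theta_vertex :=
  theta_term :: rcons [seq inr (inl (inr i)) | i <- enum 'I_b] theta_init.
Definition theta_path_c : seq theta_vertex :=
  theta_init :: rcons [seq inr (inr i) | i <- enum 'I_c] theta_term.

Definition theta_arc : rel theta_vertex := fun x y =>
  [|| consecutive theta_path_a x y, consecutive theta_path_b x y
    | consecutive theta_path_c x y].

Lemma theta_arc_irr : irreflexive theta_arc.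
Proof.
have uniq_path (I : finType) (f : I -> 'I_a + 'I_b + 'I_c) (u v : bool) :
    injective f -> u != v ->
    uniq ((inl u : theta_vertex) :: rcons [seq inr (f i) | i <- enum I] (inl v)).
  move=> injf uv; have Nl w : inl w \notin [seq inr (f i) | i <- enum I].
    by apply/mapP=> -[].
  rewrite cons_uniq rcons_uniq mem_rcons inE negb_or Nl Nl andbT /=.
  rewrite map_inj_uniq ?enum_uniq ?andbT; last by move=> i j [/injf].
  by apply: contraNneq uv => -[->].
move=> x; rewrite /theta_arc !consecutive_irr //; apply: uniq_path => //.
- by move=> i j [].
- by move=> i j [].
- by move=> i j [].
Qed.

(* The two parallel arcs of the degenerate case a = b = 0 are merged.          *)
Definition theta : digraph := Digraph theta_arc_irr.

End Theta.

(* Main.v *)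
(* Traces of powers of the adjacency matrix A give the lower bound: if y > 0   *)
(* and A y >= t y then, by strong connectivity, closed walks of length about k *)
(* number at least a constant times t ^ k, whereas their number is at most     *)
(* n rho ^ k; hence t <= rho, and t < rho as soon as A y <> t y.               *)
(* Take y x = t ^ (N - d(x, u)) with N = n - 1 and d(x, u) the distance to a   *)
(* vertex u: the inequality holds automatically outside u, and at u it says    *)
(* that the sum of t ^ (N - d(w, u)) over the out-neighbours w is >= t ^ n.    *)
(* With t the radius of theta(0,2,n-4), i.e. t ^ n = t ^ 2 + 1, this leaves,   *)
(* for two out-neighbours of u at distances p <= q, only the pairs             *)
(* (N - 2, N), (N - 1, N) and (N - 1, N - 1), and all further arcs are         *)
(* excluded by the same bound at another vertex or by a perturbed weight y.    *)

Require Import Defs.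
From mathcomp Require Import all_boot all_order all_algebra all_field.
From mathcomp Require Import spectral zify lra.

Set Implicit Arguments.
Unset Strict Implicit.
Unset Printing Implicit Defensive.

Import Order.TTheory GRing.Theory Num.Theory.
Local Open Scope ring_scope.

(** * Subinvariant vectors of irreducible matrices *)

(** The directed cycle has radius 1, and the three theta digraphs have radii [t1 < t2 < t3] in the
    interval from 1 to 2 with t1^n = t1 + 1, t2^(n-1) = 2 and t3^n = t3^2 + 1 ([model_radii]).
    Ranking them therefore reduces to [classification]: a strongly connected digraph of order n with
    radius at most [t3] has radius 1 or is isomorphic to one of the three.

    The tool is a Collatz-Wielandt comparison. A positive weight y with A y >= t y forces t <= rho,
    strictly if the inequality is strict at one vertex ([le_rho], [lt_rho]). Hence if moreover rho
    <= t, then A y = t y everywhere ([outsum_eq]). A positive y with A y <= t y gives rho <= t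
    ([rho_le]), so a positive eigenvector computes the radius.

    If no vertex has two out-neighbours, the constant vector is an eigenvector and rho = 1.
    Otherwise some u has two, and [two_out_cases] leaves three possible pairs of distances back to
    u. In each of them the vertices at a given distance from u are unique, except for one tie in the
    third case, so the distances number the vertices and force all the arcs of a model. Further arcs
    are ruled out by the equality case in [isomorphic_model3], and by [two_out], [three_out] and
    [no_triangle] in [isomorphic_model1] and [isomorphic_model2]. *)

Lemma trig_mx_expE (n : nat) (T : 'M[algC]_n) (k : nat) :
  is_trig_mx T -> is_trig_mx (T ^+ k) /\ forall i, (T ^+ k) i i = T i i ^+ k.
Proof.
move=> /is_trig_mxP Ttrig; elim: k => [|k [/is_trig_mxP IHt IHd]].
  by split=> [|i]; rewrite ?scalar_mx_is_trig // mxE eqxx.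
split=> [|i]; first apply/is_trig_mxP=> i j ltij; rewrite exprS mxE.
  apply: big1 => l _; have [ltil|leli] := ltnP i l; first by rewrite Ttrig ?mul0r.
  by rewrite IHt ?mulr0 // (leq_ltn_trans leli).
rewrite (bigD1 i) //= IHd exprS big1 ?addr0 // => l; rewrite neq_ltn.
by case/orP=> [ltli|ltil]; [rewrite IHt ?mulr0 | rewrite Ttrig ?mul0r].
Qed.

(** By Schur, A is conjugate to a triangular matrix. Conjugation keeps the trace of the k-th power,
    whose diagonal then consists of k-th powers of eigenvalues. *)
Lemma mxtrace_exp_le (n : nat) (A : 'M[algC]_n) (r : algC) (k : nat) :
  (forall z, eigenvalue A z -> `|z| <= r) -> `|\tr (A ^+ k)| <= r ^+ k *+ n.
Proof.
case: n A => [A _|n A eigA]; first by rewrite /mxtrace big_ord0 normr0 mulr0n.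
have [//|P /unitarymx_unit Punit trigP] := Schur A.
set T := conjmx P A in trigP.
have TE : T = P *m A *m invmx P by rewrite /T conjumx.
have powT : T ^+ k = P *m (A ^+ k) *m invmx P.
  elim: k => [|k IHk]; first by rewrite mulmx1 mulmxV.
  by rewrite !exprS IHk TE -!mulmxE !mulmxA mulmxKV.
have -> : \tr (A ^+ k) = \tr (T ^+ k).
  by rewrite powT mxtrace_mulC mulmxA mulVmx ?mul1mx.
have eigT i : eigenvalue A (T i i).
  have : eigenvalue T (T i i).
    rewrite eigenvalue_root_char char_poly_trig // rootE horner_prod.
    by rewrite (bigD1 i) //= hornerXsubC subrr mul0r.
  by apply: eigenvalue_conjmx; rewrite ?row_free_unit ?stablemx_unit.
have [_ diagT] := trig_mx_expE k trigP.
rewrite /mxtrace (eq_bigr _ (fun i _ => diagT i)).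
apply: le_trans (ler_norm_sum _ _ _) _; rewrite -[X in _ *+ X]card_ord -sumr_const.
apply: ler_sum => i _; rewrite normrX.
rewrite lerXn2r ?nnegrE // ?(le_trans (normr_ge0 (T i i))) //.
all: exact: eigA (eigT i).
Qed.

Lemma ler_1DMn_exprn (R : realDomainType) (e : R) (k : nat) :
  0 <= e -> 1 + e *+ k <= (1 + e) ^+ k.
Proof.
move=> e0; elim: k => [|k IHk]; first by rewrite mulr0n addr0.
have ek0 : 0 <= e *+ k by rewrite mulrn_wge0.
rewrite exprS mulrS; have := ler_wpM2l (addr_ge0 ler01 e0) IHk; nra.
Qed.

(** If r < s with r > 0, Bernoulli's inequality makes (s / r)^k unbounded, yet it stays below b /
    c. *)
Lemma ler_of_expr_bound (R : archiRealFieldType) (s r c b : R) :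
  0 <= r -> 0 < c -> (forall k, s ^+ k * c <= r ^+ k * b) -> s <= r.
Proof.
move=> r0 c0 bound; rewrite leNgt; apply/negP => ltrs.
have [r_eq0|r_neq0] := eqVneq r 0.
  have := bound 1%N; rewrite r_eq0 !expr1 mul0r leNgt mulr_gt0 //.
  by rewrite -r_eq0.
have r_gt0 : 0 < r by rewrite lt_def r_neq0.
pose e := s / r - 1.
have e_gt0 : 0 < e by rewrite subr_gt0 ltr_pdivlMr // mul1r.
have boundk k : 1 + e *+ k <= b / c.
  apply: le_trans (ler_1DMn_exprn k (ltW e_gt0)) _.
  have -> : 1 + e = s / r by rewrite /e addrC subrK.
  rewrite ler_pdivlMr // expr_div_n mulrAC ler_pdivrMr ?exprn_gt0 //.
  by rewrite [b * _]mulrC.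
have b0 : 0 <= b / c / e.
  by rewrite divr_ge0 ?(ltW e_gt0) // (le_trans _ (boundk 0%N)) // mulr0n addr0.
have := archi_boundP b0; rewrite ltr_pdivrMr // => lt_b.
have := boundk (Num.Def.archi_bound (b / c / e)).
by rewrite -mulr_natl; lra.
Qed.

Lemma expmx_ge0 (n : nat) (A : 'M[algR]_n) k i j :
  (forall i j, 0 <= A i j) -> 0 <= (A ^+ k) i j.
Proof.
move=> A0; elim: k i j => [|k IHk] i j; first by rewrite mxE; case: eqP.
by rewrite exprS mxE sumr_ge0 // => l _; rewrite mulr_ge0 .
Qed.

Definition irreducible_mx (n : nat) (A : 'M[algR]_n) : Prop :=
  (forall i j, 0 <= A i j) /\ (forall i j, exists d : nat, 0 < (A ^+ d) i j).

Section Irreducible.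
Variables (n : nat) (A : 'M[algR]_n) (r : algR).
Hypothesis irrA : irreducible_mx A.
Hypothesis eigA : forall z, eigenvalue (map_mx algRval A) z -> `|z| <= algRval r.

Lemma expmx_diag_le k i : (A ^+ k) i i <= r ^+ k *+ n.
Proof.
have trle : \tr (A ^+ k) <= r ^+ k *+ n.
  have mapX : map_mx algRval A ^+ k = map_mx algRval (A ^+ k).
    elim: k => [|k IHk]; first by rewrite !expr0 map_mx1.
    by rewrite !exprS IHk -!mulmxE map_mxM.
  have := mxtrace_exp_le k eigA; rewrite mapX trace_map_mx -rmorphXn -rmorphMn.
  exact: le_trans (real_ler_norm (algRvalP _)).
apply: le_trans trle; rewrite /mxtrace (bigD1 i) //= lerDl sumr_ge0 // => l _.
exact: expmx_ge0 irrA.1.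
Qed.

Lemma eigenvalue_bound_ge0 : 'I_n -> 0 <= r.
Proof.
move=> i; have := le_trans (expmx_ge0 1 i i irrA.1) (expmx_diag_le 1 i).
by rewrite expr1 pmulrn_lge0 //; case: (n) i => // -[].
Qed.

(** Iterating gives A^k y >= s^k y, while the entries of A^k grow no faster than a constant times
    r^k. *)
Lemma subinvariant_le (y : 'cV[algR]_n) (s : algR) (i0 : 'I_n) :
  (forall i, 0 < y i 0) -> (forall i, s * y i 0 <= (A *m y) i 0) -> s <= r.
Proof.
move=> y0 Ay; have r0 := eigenvalue_bound_ge0 i0.
have [s0|s_lt0] := leP 0 s; last exact: le_trans (ltW s_lt0) r0.
have Aky k i : s ^+ k * y i 0 <= (A ^+ k *m y) i 0.
  elim: k i => [|k IHk] i; first by rewrite mul1mx mul1r.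
  rewrite [in leRHS]exprS -mulmxE -mulmxA mxE.
  apply: (@le_trans _ _ (s ^+ k * (A *m y) i 0)).
    by rewrite exprSr -mulrA ler_wpM2l // exprn_ge0.
  rewrite mxE mulr_sumr ler_sum // => j _.
  by rewrite mulrCA ler_wpM2l // irrA.1.
have [d d_gt0] := fin_all_exists (fun j => irrA.2 j i0).
(* Since (A^k) i0 j times (A^(d j)) j i0 is one term of the diagonal entry of A^(k + d j) at i0, it
   is at most n r^(k + d j). *)
pose b := \sum_j (r ^+ d j *+ n) / (A ^+ d j) j i0 * y j 0.
apply: (@ler_of_expr_bound _ _ _ (y i0 0) b) => // k.
apply: le_trans (Aky k i0) _; rewrite mxE mulr_sumr ler_sum // => j _.
rewrite !mulrA ler_wpM2r ?(ltW (y0 j)) // ler_pdivlMr // mulrnAr -exprD.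
apply: le_trans (expmx_diag_le _ i0); rewrite exprD -mulmxE mxE (bigD1 j) //= lerDl.
by rewrite sumr_ge0 // => l _; rewrite mulr_ge0 ?(expmx_ge0 _ _ _ irrA.1).
Qed.

(** The matrix [M] commutes with A and has a positive column at [i0], so it spreads the strict
    inequality at [i0] to all coordinates: w = M y satisfies A w > s w everywhere, which leaves room
    to enlarge s. *)
Lemma subinvariant_lt (y : 'cV[algR]_n) (s : algR) (i0 : 'I_n) :
    (forall i, 0 < y i 0) -> (forall i, s * y i 0 <= (A *m y) i 0) ->
  s * y i0 0 < (A *m y) i0 0 -> s < r.
Proof.
move=> y0 Ay Ay0.
have [d d_gt0] := fin_all_exists (fun j => irrA.2 j i0).
pose M := \sum_j A ^+ d j; pose w := M *m y.
have M_ge0 i j : 0 <= M i j.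
  by rewrite summxE sumr_ge0 // => l _; apply: expmx_ge0 irrA.1.
have M_gt0 j : 0 < M j i0.
  rewrite summxE (bigD1 j) //= ltr_wpDr // sumr_ge0 // => l _.
  exact: expmx_ge0 irrA.1.
have w_gt0 j : 0 < w j 0.
  rewrite mxE (bigD1 i0) //= ltr_wpDr ?mulr_gt0 // sumr_ge0 // => l _.
  by rewrite mulr_ge0 // ltW.
pose z := A *m y - s *: y.
have AwE : A *m w - s *: w = M *m z.
  rewrite /z mulmxBr -scalemxAr; congr (_ - _).
  rewrite !mulmxA; congr (_ *m _); rewrite mulmx_sumr mulmx_suml.
  by apply: eq_bigr => j _; rewrite mulmxE -exprS exprSr.
have zE i : z i 0 = (A *m y) i 0 - s * y i 0 by rewrite /z !mxE.
have z_ge0 i : 0 <= z i 0 by rewrite zE subr_ge0.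
have Mz_gt0 j : 0 < (M *m z) j 0.
  rewrite mxE (bigD1 i0) //= ltr_wpDr ?mulr_gt0 ?zE ?subr_gt0 //.
  by rewrite sumr_ge0 // => l _; rewrite mulr_ge0.
(* [c] exceeds every ratio of w to A w - s w, so w is subinvariant for s + 1/c. *)
pose c := 1 + \sum_j w j 0 / (M *m z) j 0.
have wc j : w j 0 <= c * (M *m z) j 0.
  rewrite -ler_pdivrMr // /c (bigD1 j) //=.
  suff : 0 <= \sum_(l | l != j) w l 0 / (M *m z) l 0 by lra.
  by rewrite sumr_ge0 // => l _; rewrite divr_ge0 ?ltW.
have c_gt0 : 0 < c.
  rewrite ltr_wpDr // sumr_ge0 // => l _.
  by rewrite divr_ge0 ?ltW.
apply: (@lt_le_trans _ _ (s + c^-1)); first by rewrite ltrDl invr_gt0.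
apply: (@subinvariant_le w _ i0) => // j.
have := wc j; rewrite -ler_pdivrMl // -AwE !mxE; lra.
Qed.
End Irreducible.

(** * Spectral radii of digraphs *)

Lemma spectral_radius_real (D : digraph) : spectral_radius D \is Creal.
Proof.
rewrite /spectral_radius; elim/big_ind: _ => // [x y xR yR|z _].
  by rewrite /Order.max; case: ifP.
exact: normr_real.
Qed.

Definition rho (D : digraph) : algR := in_algR (spectral_radius_real D).

Definition outsum (D : digraph) (y : D -> algR) (x : D) : algR :=
  \sum_(z | darc x z) y z.

Lemma outsum_adjacency (D : digraph) (y : D -> algR) (i : 'I_(digraph_order D)) :
  \sum_(j < digraph_order D) (darc (enum_val i : D) (enum_val j))%:R * y (enum_val j) =
  outsum y (enum_val i).
Proof.
rewrite /outsum (reindex_onto (fun j : 'I_(digraph_order D) => enum_val j : D)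
  (@enum_rank D)) /=; last first.
  by move=> x _; rewrite enum_rankK.
rewrite [RHS]big_mkcond /=; apply: eq_bigr => j _.
by rewrite enum_valK eqxx andbT mulr_natl mulrb.
Qed.

Definition adjacencyR (D : digraph) : 'M[algR]_(digraph_order D) :=
  \matrix_(i, j) (darc (enum_val i : D) (enum_val j))%:R.

Lemma adjacencyRE (D : digraph) : map_mx algRval (adjacencyR D) = adjacency D.
Proof. by apply/matrixP => i j; rewrite !mxE rmorph_nat. Qed.

Lemma adjacencyR_irreducible (D : digraph) :
  strongly_connected D -> irreducible_mx (adjacencyR D).
Proof.
move=> scD; have A0 i j : 0 <= adjacencyR D i j by rewrite mxE ler0n.
split=> // i j; have /connectP[p pth lastp] := scD (enum_val i) (enum_val j).
exists (size p).
elim: p i pth lastp => [|x p IHp] i /= => [_ /enum_val_inj->|].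
  by rewrite mxE eqxx.
case/andP=> ix pth lastp; rewrite exprS mxE (bigD1 (enum_rank x)) //=.
have xj : 0 < (adjacencyR D ^+ size p) (enum_rank x) j.
  by apply: IHp; rewrite enum_rankK.
rewrite ltr_wpDr ?mxE ?enum_rankK ?ix ?mul1r //.
by rewrite sumr_ge0 // => l _; rewrite mulr_ge0 ?A0 ?(expmx_ge0 _ _ _ A0).
Qed.

Lemma adjacencyR_eigenvalue_le (D : digraph) (z : algC) :
  eigenvalue (map_mx algRval (adjacencyR D)) z -> `|z| <= algRval (rho D).
Proof. by rewrite adjacencyRE; apply: spectral_radius_ge. Qed.

Lemma adjacencyR_mul (D : digraph) (y : D -> algR) i :
  (adjacencyR D *m \col_j y (enum_val j)) i 0 = outsum y (enum_val i).
Proof.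
by rewrite mxE -outsum_adjacency; apply: eq_bigr => j _; rewrite !mxE.
Qed.

Section Subinvariant.
Variables (D : digraph) (y : D -> algR) (t : algR).
Hypothesis y_gt0 : forall x, 0 < y x.

Lemma le_rho (x0 : D) : strongly_connected D ->
  (forall x, t * y x <= outsum y x) -> t <= rho D.
Proof.
move=> /adjacencyR_irreducible irrD ty.
apply: (subinvariant_le irrD (@adjacencyR_eigenvalue_le D)
         (y := \col_j y (enum_val j)) (enum_rank x0)) => i; first by rewrite mxE.
by rewrite adjacencyR_mul mxE.
Qed.

Lemma lt_rho (x0 : D) : strongly_connected D ->
    (forall x, t * y x <= outsum y x) -> t * y x0 < outsum y x0 ->
  t < rho D.
Proof.
move=> /adjacencyR_irreducible irrD ty ty0.
apply: (subinvariant_lt irrD (@adjacencyR_eigenvalue_le D)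
         (y := \col_j y (enum_val j)) (i0 := enum_rank x0)) => [i|i|].
  by rewrite mxE.
  by rewrite adjacencyR_mul mxE.
by rewrite adjacencyR_mul mxE enum_rankK.
Qed.

(** Pair the moduli of a left eigenvector v for z with y: |z| times the sum of |v i| y i is at most
    the sum of |v k| (A y) k, hence at most t times the same positive sum. *)
Lemma rho_le (x0 : D) : (forall x, outsum y x <= t * y x) -> rho D <= t.
Proof.
move=> ty; have [|z /eigenvalueP[v vA v0] zE] := @spectral_radius_attained D.
  by rewrite /digraph_order (cardD1 x0).
change (algRval (rho D) <= algRval t); rewrite /= -zE.
pose Y (i : 'I_(digraph_order D)) : algC := algRval (y (enum_val i)).
have Y_gt0 i : 0 < Y i by apply: y_gt0.
pose S := \sum_i `|v 0 i| * Y i.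
have [i vi0] : exists i, v 0 i != 0.
  by apply/existsP; apply: contraNT v0 => /existsPn v0; apply/eqP/rowP=> i;
     apply/eqP; rewrite mxE; move: (v0 i); rewrite negbK.
have S_gt0 : 0 < S.
  rewrite /S (bigD1 i) //= ltr_wpDr ?mulr_gt0 ?normr_gt0 //.
  by rewrite sumr_ge0 // => j _; rewrite mulr_ge0 // ltW.
rewrite -(ler_pM2r S_gt0) /S mulr_sumr.
apply: (@le_trans _ _ (\sum_j \sum_k `|v 0 k| * adjacency D k j * Y j)).
  apply: ler_sum => j _; rewrite mulrA -mulr_suml ler_wpM2r ?(ltW (Y_gt0 j)) //.
  have := congr1 (fun w : 'rV_(digraph_order D) => w 0 j) vA; rewrite [RHS]mxE => vAj.
  rewrite -normrM -vAj mxE; apply: le_trans (ler_norm_sum _ _ _) _.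
  apply: ler_sum => k _; rewrite normrM ler_wpM2l //.
  by rewrite mxE normr_nat.
rewrite exchange_big mulr_sumr /= ler_sum // => k _.
under eq_bigr do rewrite -mulrA; rewrite -mulr_sumr mulrCA ler_wpM2l //.
have : outsum y (enum_val k) <= t * y (enum_val k) by [].
rewrite -outsum_adjacency => le_k.
have -> : \sum_j adjacency D k j * Y j =
   algRval (\sum_(j < digraph_order D)
     (darc (enum_val k : D) (enum_val j))%:R * y (enum_val j)).
  by rewrite rmorph_sum; apply: eq_bigr => j _; rewrite rmorphM rmorph_nat mxE.
exact: le_k.
Qed.

Lemma rho_eq (x0 : D) : strongly_connected D ->
  (forall x, outsum y x = t * y x) -> rho D = t.
Proof.
by move=> scD ty; apply/eqP; rewrite eq_le rho_le ?le_rho // => x; rewrite ty.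
Qed.

Lemma outsum_eq : strongly_connected D -> (forall x, t * y x <= outsum y x) ->
  rho D <= t -> forall x, outsum y x = t * y x.
Proof.
move=> scD ty; rewrite leNgt => /negP rho_t x; apply/eqP; rewrite eq_le ty andbT.
by rewrite leNgt; apply/negP => /(lt_rho scD ty).
Qed.
End Subinvariant.

(** * Isomorphisms and extremal models *)

Lemma isomorphic_sym (D E : digraph) : isomorphic D E -> isomorphic E D.
Proof.
case=> f [g fK gK] fD; exists g; first by exists f.
by move=> x y; rewrite -fD !gK.
Qed.

Lemma isomorphic_trans (D E F : digraph) :
  isomorphic D E -> isomorphic E F -> isomorphic D F.
Proof.
move=> [f f_bij fD] [g g_bij gE]; exists (g \o f); first exact: bij_comp.
by move=> x y; rewrite gE fD.
Qed.

Lemma isomorphic_order (D E : digraph) :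
  isomorphic D E -> digraph_order D = digraph_order E.
Proof. by case=> f f_bij _; exact: bij_eq_card f_bij. Qed.

Lemma isomorphic_strongly_connected (D E : digraph) :
  isomorphic D E -> strongly_connected D -> strongly_connected E.
Proof.
case=> f [g fK gK] fD scD x y; rewrite -(gK x) -(gK y).
have /connectP[p pth ->] := scD (g x) (g y).
elim: p (g x) pth => [|z p IHp] w //= /andP[wz pth].
by apply: connect_trans (IHp z pth); rewrite connect1 // fD.
Qed.

Lemma isomorphic_rho (D E : digraph) (y : E -> algR) (t : algR) (x0 : E) :
    isomorphic D E -> strongly_connected E -> (forall x, 0 < y x) ->
  (forall x, outsum y x = t * y x) -> rho D = t.
Proof.
move=> isoDE scE y0 ty; have [f [g fK gK] fD] := isoDE.
apply: (@rho_eq D (y \o f)) => //=; first exact: (g x0).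
  exact: isomorphic_strongly_connected (isomorphic_sym isoDE) scE.
move=> x; rewrite -ty /outsum (reindex_onto g f) /=.
  by apply: eq_big => [z|z _]; rewrite ?gK // eqxx andbT -fD gK.
by move=> z _; rewrite fK.
Qed.

Section OutSum.
Variables (D : digraph) (y : D -> algR).

Lemma outsum_seq (x : D) (s : seq D) : uniq s ->
  (forall z, darc x z = (z \in s)) -> outsum y x = \sum_(z <- s) y z.
Proof. by move=> Us xs; rewrite /outsum big_uniq //; apply: eq_bigl. Qed.

Hypothesis y_gt0 : forall x, 0 < y x.

Lemma outsum_split (x : D) (s : seq D) : uniq s -> all (darc x) s ->
  outsum y x =
  \sum_(z <- s) y z + \sum_(z | darc x z && (z \notin s)) y z.
Proof.
move=> Us /allP xs; rewrite /outsum (bigID (mem s)) /= big_uniq //; congr (_ + _).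
by apply: eq_bigl => z; rewrite andb_idl // => /xs.
Qed.

Lemma outsum_ge (x : D) (s : seq D) : uniq s -> all (darc x) s ->
  \sum_(z <- s) y z <= outsum y x.
Proof.
move=> Us xs; rewrite (outsum_split Us xs) lerDl sumr_ge0 // => z _.
exact: ltW.
Qed.

Lemma outsum_eq_seq (x : D) (s : seq D) : uniq s -> all (darc x) s ->
  outsum y x = \sum_(z <- s) y z -> forall z, darc x z = (z \in s).
Proof.
move=> Us xs; rewrite (outsum_split Us xs) => /eqP.
rewrite -subr_eq0 addrC addKr => /eqP s0 z.
apply/idP/idP => [xz|/(allP xs)//]; apply/negPn/negP => zs.
move: s0; rewrite (bigD1 z) /= ?xz //.
apply/eqP; rewrite gt_eqF // ltr_wpDr // sumr_ge0 // => w _.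
exact: ltW.
Qed.
End OutSum.

(** * Models on the vertices 0, ..., n - 1 and their radii *)

Definition ord_digraph (n : nat) (e : rel nat) (e_irr : irreflexive e) : digraph :=
  @Digraph 'I_n (relpre val e) (fun i => e_irr (val i)).

(** The first condition leads every vertex down to 0; the second lets 0 reach every vertex, by
    induction from the largest label downwards. *)
Lemma ord_digraph_strongly_connected (n : nat) (e : rel nat) (e_irr : irreflexive e) :
    (forall i, (0 < i < n)%N -> exists2 j, (j < i)%N & e i j) ->
    (forall i, (0 < i < n)%N -> e 0 i \/ exists2 j, (i < j < n)%N & e j i) ->
  strongly_connected (ord_digraph n e_irr).
Proof.
move=> down up; case: n down up => [|n] down up x y; first by case: x.
pose D := ord_digraph n.+1 e_irr; pose o : D := ord0 : 'I_n.+1.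
apply: (@connect_trans _ _ o).
  case: x => i; elim/ltn_ind: i => i IHi lti.
  have [i0|i_gt0] := posnP i.
    by rewrite (_ : Ordinal lti = o) ?connect0 //; apply: val_inj.
  have [|j ltj ij] := down i; first by rewrite i_gt0.
  have ltjn := ltn_trans ltj lti.
  by apply: connect_trans (IHi j ltj ltjn); apply: connect1.
case: y => i lti; move: {2}(n - i)%N (leqnn (n - i)) => k.
elim: k i lti => [|k IHk] i lti.
all: have [i0|i_gt0] := posnP i;
  first by rewrite (_ : Ordinal lti = o) ?connect0 //; apply: val_inj.
all: move=> le_k; have [|oi|[j /andP[ltij ltjn] ji]] := up i; rewrite ?i_gt0 //;
  first exact: connect1.
  by move: ltjn; rewrite ltnS leqNgt; have := ltij; lia.
apply: (connect_trans (IHk j ltjn _)); first by lia.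
exact: connect1.
Qed.

Definition cycle_arc (N : nat) : rel nat :=
  fun i j => (i == j.+1) || (i == 0%N) && (j == N).
(* [model1], [model2] and [model3] are theta(0,1,n-3), theta(1,1,n-4) and      *)
(* theta(0,2,n-4) with n = N + 1, numbered so that 0 is the vertex of          *)
(* out-degree two and arcs decrease the number by one, apart from those        *)
(* leaving 0 and, in [model2], from the arc N -> N - 2.                        *)
Definition model1_arc (N : nat) : rel nat :=
  fun i j => (i == j.+1) || (i == 0%N) && ((j == N) || (j.+1 == N)).
Definition model2_arc (N : nat) : rel nat := fun i j =>
  [|| (i == j.+1) && (i < N)%N, (i == N) && (j.+2 == N)
    | (i == 0%N) && ((j == N) || (j.+1 == N))].
Definition model3_arc (N : nat) : rel nat :=
  fun i j => (i == j.+1) || (i == 0%N) && ((j == N) || (j.+2 == N)).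

Section Models.
Variable m : nat.
Local Notation N := m.+3.

Lemma cycle_arc_irr : irreflexive (cycle_arc N).
Proof. by move=> i; rewrite /cycle_arc; lia. Qed.
Lemma model1_arc_irr : irreflexive (model1_arc N).
Proof. by move=> i; rewrite /model1_arc; lia. Qed.
Lemma model2_arc_irr : irreflexive (model2_arc N).
Proof. by move=> i; rewrite /model2_arc; lia. Qed.
Lemma model3_arc_irr : irreflexive (model3_arc N).
Proof. by move=> i; rewrite /model3_arc; lia. Qed.

Definition cycle_digraph := ord_digraph N.+1 cycle_arc_irr.
Definition model1 := ord_digraph N.+1 model1_arc_irr.
Definition model2 := ord_digraph N.+1 model2_arc_irr.
Definition model3 := ord_digraph N.+1 model3_arc_irr.

Lemma cycle_strongly_connected : strongly_connected cycle_digraph.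
Proof.
apply: ord_digraph_strongly_connected => i /andP[i0 iN].
  by exists i.-1; rewrite /cycle_arc; lia.
have [->|neq] := eqVneq i N; first by left; rewrite /cycle_arc; lia.
by right; exists i.+1; rewrite /cycle_arc; lia.
Qed.

Lemma model1_strongly_connected : strongly_connected model1.
Proof.
apply: ord_digraph_strongly_connected => i /andP[i0 iN].
  by exists i.-1; rewrite /model1_arc; lia.
have [->|neq] := eqVneq i N; first by left; rewrite /model1_arc; lia.
by right; exists i.+1; rewrite /model1_arc; lia.
Qed.

Lemma model2_strongly_connected : strongly_connected model2.
Proof.
apply: ord_digraph_strongly_connected => i /andP[i0 iN].
  have [->|neq] := eqVneq i N; first by exists m.+1; rewrite /model2_arc; lia.
  by exists i.-1; rewrite /model2_arc; lia.
have [le|lt] := leqP m.+2 i; first by left; rewrite /model2_arc; lia.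
by right; exists i.+1; rewrite /model2_arc; lia.
Qed.

Lemma model3_strongly_connected : strongly_connected model3.
Proof.
apply: ord_digraph_strongly_connected => i /andP[i0 iN].
  by exists i.-1; rewrite /model3_arc; lia.
have [->|neq] := eqVneq i N; first by left; rewrite /model3_arc; lia.
by right; exists i.+1; rewrite /model3_arc; lia.
Qed.

Variables (D : digraph) (t : algR).
Hypothesis t_gt1 : 1 < t.

Let yN (i : nat) : algR := t ^+ (N - i).
Let yN_gt0 i : 0 < yN i. Proof. by rewrite exprn_gt0 // (lt_trans ltr01). Qed.
Let yNS (i : nat) : (i < N)%N -> yN i = t * yN i.+1.
Proof. by move=> iN; rewrite /yN -exprS; congr (_ ^+ _); lia. Qed.

Let yN0 : t * yN 0 = t ^+ N.+1. Proof. by rewrite exprS. Qed.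
Let yN1 : yN N = 1. Proof. by rewrite /yN subnn. Qed.
Let yN2 : yN m.+2 = t. Proof. by rewrite yNS // yN1 mulr1. Qed.
Let ltS1 : (m.+1 < m.+4)%N. Proof. by lia. Qed.
Let yN3 : yN m.+1 = t ^+ 2. Proof. by rewrite yNS // yN2. Qed.

(** The weights t^(N - i) form an eigenvector: each arc from i + 1 to i multiplies by t, and the
    condition at 0 is the equation for t. *)
Lemma model1_rho : t ^+ N.+1 = t + 1 -> isomorphic D model1 -> rho D = t.
Proof.
move=> tE isoD.
apply: (isomorphic_rho (y := fun i : model1 => yN (val (i : 'I_N.+1)))
          (ord0 : 'I_N.+1) isoD model1_strongly_connected) => // -[[|i] lti] /=.
  rewrite (@outsum_seq model1 _ _ [:: (inord N : 'I_N.+1); (inord m.+2 : 'I_N.+1)]).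
  - by rewrite big_cons big_seq1 !inordK // yN0 yN1 yN2 tE addrC.
  - by rewrite /= inE -val_eqE /= !inordK //; lia.
  - by move=> z; rewrite !inE -!val_eqE /= !inordK // /model1_arc; lia.
have ltiN : (i < N.+1)%N by lia.
rewrite (@outsum_seq model1 _ _ [:: (Ordinal ltiN : 'I_N.+1)]) ?big_seq1 //= -1?yNS //.
by move=> z; rewrite !inE -!val_eqE /= /model1_arc; lia.
Qed.

Lemma model3_rho : t ^+ N.+1 = t ^+ 2 + 1 -> isomorphic D model3 -> rho D = t.
Proof.
move=> tE isoD.
apply: (isomorphic_rho (y := fun i : model3 => yN (val (i : 'I_N.+1)))
          (ord0 : 'I_N.+1) isoD model3_strongly_connected) => // -[[|i] lti] /=.
  rewrite (@outsum_seq model3 _ _ [:: (inord N : 'I_N.+1); (inord m.+1 : 'I_N.+1)]).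
  - by rewrite big_cons big_seq1 !inordK ?ltS1 // yN0 yN1 yN3 tE addrC.
  - by rewrite /= inE -val_eqE /= !inordK ?ltS1 //; lia.
  - by move=> z; rewrite !inE -!val_eqE /= !inordK ?ltS1 // /model3_arc; lia.
have ltiN : (i < N.+1)%N by lia.
rewrite (@outsum_seq model3 _ _ [:: (Ordinal ltiN : 'I_N.+1)]) ?big_seq1 //= -1?yNS //.
by move=> z; rewrite !inE -!val_eqE /= /model3_arc; lia.
Qed.

(** Both N and N - 1 have N - 2 as only out-neighbour, so they carry the same weight; [l] gives N
    the label N - 1. The condition at 0 becomes t^(N+1) = 2 t. *)
Lemma model2_rho : t ^+ N = 2 -> isomorphic D model2 -> rho D = t.
Proof.
move=> tE isoD; pose l (i : nat) := if i == N then m.+2 else i.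
apply: (isomorphic_rho (y := fun i : model2 => yN (l (val (i : 'I_N.+1))))
          (ord0 : 'I_N.+1) isoD model2_strongly_connected) => // -[i lti] /=.
have [i0|i_neq0] := eqVneq i 0%N.
  rewrite (@outsum_seq model2 _ _ [:: (inord N : 'I_N.+1); (inord m.+2 : 'I_N.+1)]).
  - rewrite big_cons big_seq1 !inordK // i0 /l eqxx if_same.
    by rewrite yN0 yN2 exprS tE; lra.
  - by rewrite /= inE -val_eqE /= !inordK //; lia.
  - by move=> z; rewrite !inE -!val_eqE /= !inordK // /model2_arc; lia.
pose j := if i == N then m.+1 else i.-1.
have ltj : (j < N.+1)%N by rewrite /j; case: eqP; lia.
rewrite (@outsum_seq model2 _ _ [:: (Ordinal ltj : 'I_N.+1)]) ?big_seq1 //=.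
  have -> : l i = (l j).+1 by rewrite /l /j; repeat case: eqP; lia.
  by rewrite -yNS // /l /j; repeat case: eqP; lia.
by move=> z; rewrite !inE -!val_eqE /= /model2_arc /j; case: (eqVneq i N) => ?; lia.
Qed.
End Models.

Lemma outdeg1_rho (D : digraph) (x0 : D) (g : D -> D) : strongly_connected D ->
  (forall x z, darc x z = (z == g x)) -> rho D = 1.
Proof.
move=> scD gD; apply: (@rho_eq D (fun=> 1)) => // x.
rewrite (@outsum_seq _ _ _ [:: g x]) ?big_seq1 ?mulr1 // => z.
by rewrite inE gD.
Qed.

Lemma cycle_rho (m : nat) : rho (cycle_digraph m) = 1.
Proof.
apply: (@outdeg1_rho (cycle_digraph m) (ord0 : 'I_m.+4)
  (fun x : 'I_m.+4 => inord (if val x == 0%N then m.+3 else (val x).-1) : 'I_m.+4)).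
  exact: cycle_strongly_connected.
move=> [x ltx] [z ltz]; rewrite -val_eqE /= inordK; last by case: eqP; lia.
by rewrite /cycle_arc; case: (eqVneq x 0%N) => ?; lia.
Qed.

Lemma algR_root_between1_2 (p : {poly algR}) :
  p.[1] < 0 -> 0 <= p.[2] -> exists2 t, 1 < t & p.[t] = 0.
Proof.
move=> p1 p2; have [|x /andP[x1 _] /rootP px] := @poly_ivt _ p 1 2 (ler1n _ 2).
  by rewrite (ltW p1).
exists x => //; rewrite lt_def x1 andbT; apply: contraTneq p1 => <-.
by rewrite px ltxx.
Qed.

Lemma exprn2_ge16 (m : nat) : (16 : algR) <= 2 ^+ m.+4.
Proof.
rewrite (_ : 16 = 2 ^+ 4); first by rewrite ler_weXn2l // ler1n.
by rewrite -natrX.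
Qed.

(** The roots come from sign changes between 1 and 2. The order follows from t1^n = t1 + 1 < 2 t1
    and t3^n = t3^2 + 1 > 2 t3, compared with t2^(n-1) = 2; and t3 >= 2 would contradict t3^4 <=
    t3^n = t3^2 + 1. *)
Lemma model_radii (m : nat) : exists t : algR * algR * algR,
  [/\ t.1.1 ^+ m.+4 = t.1.1 + 1, t.1.2 ^+ m.+3 = 2, t.2 ^+ m.+4 = t.2 ^+ 2 + 1
    & [/\ 1 < t.1.1, t.1.1 < t.1.2, t.1.2 < t.2 & t.2 < 2]].
Proof.
have pow2 := exprn2_ge16 m; have pow2' := exprS (2 : algR) m.+3.
have [||t1 t1_gt1] := @algR_root_between1_2 ('X^(m.+4) - 'X - 1)%R.
- by rewrite !hornerE /= !expr1n; lra.
- by rewrite !hornerE /=; lra.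
rewrite !hornerE => t1E.
have [||t2 t2_gt1] := @algR_root_between1_2 ('X^(m.+3) - 2%:P)%R.
- by rewrite !hornerE /= !expr1n; lra.
- by rewrite !hornerE /=; lra.
rewrite !hornerE => t2E.
have [||t3 t3_gt1] := @algR_root_between1_2 ('X^(m.+4) - 'X^2 - 1)%R.
- by rewrite !hornerE /= !expr1n; lra.
- by rewrite !hornerE /=; lra.
rewrite !hornerE => t3E.
have pow_lt (a b : algR) : 0 < a -> 0 < b -> a ^+ m.+3 < b ^+ m.+3 -> a < b.
  move=> a0 b0; rewrite !ltNge; apply: contra => leba.
  by rewrite lerXn2r // nnegrE ltW.
have t1S := exprS t1 m.+3; have t3S := exprS t3 m.+3.
exists (t1, t2, t3); split=> /=; [lra|lra|lra|split=> //].
- apply: pow_lt; [lra|lra|rewrite -(ltr_pM2l (_ : 0 < t1))]; last by lra.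
  rewrite -t1S (_ : t2 ^+ m.+3 = 2); lra.
- apply: pow_lt; [lra|lra|rewrite -(ltr_pM2l (_ : 0 < t3))]; last by lra.
  rewrite -t3S (_ : t2 ^+ m.+3 = 2); last lra.
  by rewrite (_ : t3 ^+ m.+4 = t3 ^+ 2 + 1); [nra|lra].
rewrite ltNge; apply/negP => t3_ge2.
have : t3 ^+ 4 <= t3 ^+ m.+4 by rewrite ler_weXn2l // ltW.
rewrite (_ : t3 ^+ m.+4 = t3 ^+ 2 + 1); last by lra.
have sq : 4 <= t3 ^+ 2 by clear -t3_ge2; nra.
rewrite (exprM t3 2 2); clear -sq; nra.
Qed.

(** * Theta digraphs *)

Lemma consecutive_map (T S : eqType) (f : T -> S) (p : seq T) (x y : T) :
  injective f -> consecutive (map f p) (f x) (f y) = consecutive p x y.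
Proof.
move=> injf; rewrite /consecutive behead_map.
rewrite (_ : zip _ _ = map (fun z => (f z.1, f z.2)) (zip p (behead p))).
  rewrite (mem_map (f := fun z => (f z.1, f z.2)) _ _ (x, y)) //.
  by move=> -[a b] [c e] [/injf-> /injf->].
by elim: p => //= a [|b p] //= [->].
Qed.

Lemma consecutive_rev_iota (k i j : nat) :
  consecutive (rev (iota 0 k)) i j = (i == j.+1) && (i < k)%N.
Proof.
have revS l : rev (iota 0 l.+1) = l :: rev (iota 0 l).
  by rewrite -[l.+1]addn1 iotaD rev_cat.
elim: k => [|[|k] IHk]; first by rewrite ltn0 andbF.
  by rewrite /consecutive /= !ltnS; case: i {IHk} => [|i]; rewrite ?andbF.
move: IHk; rewrite /consecutive revS [rev (iota 0 k.+2)]revS revS /= inE => ->.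
by rewrite xpair_eqE; lia.
Qed.

Lemma isomorphic_theta (a b c : nat) (n : nat) (e : rel nat) (e_irr : irreflexive e)
    (f : theta a b c -> nat) : (a + b + c).+2 = n -> injective f ->
    (forall x, (f x < n)%N) -> (forall x y, darc x y = e (f x) (f y)) ->
  isomorphic (theta a b c) (ord_digraph n e_irr).
Proof.
move=> cardE f_inj f_lt fe.
exists (fun x => Ordinal (f_lt x) : ord_digraph n e_irr) => //.
apply: inj_card_bij; first by move=> x y [/f_inj].
by rewrite card_ord /= !card_sum !card_ord card_bool; lia.
Qed.

Section ThetaLabel.
Variables (a b c : nat) (la lb : nat -> nat).

(** The path with c internal vertices is numbered downwards c + 1, c, ..., 0, ending at the
    branching vertex 0. The two other paths run from 0 to c + 1, and their interiors take the free
    labels [la] and [lb], as the models require. *)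
Definition theta_label (x : theta a b c) : nat :=
  match (x : bool + ('I_a + 'I_b + 'I_c)) with
  | inl z => if z then 0%N else c.+1
  | inr (inl (inl i)) => la i
  | inr (inl (inr i)) => lb i
  | inr (inr i) => (c - i)%N
  end.

Lemma theta_label_arc (x y : theta a b c) : injective theta_label ->
  darc x y =
  [|| consecutive (0%N :: rcons [seq la i | i <- iota 0 a] c.+1)
        (theta_label x) (theta_label y),
      consecutive (0%N :: rcons [seq lb i | i <- iota 0 b] c.+1)
        (theta_label x) (theta_label y)
    | (theta_label x == (theta_label y).+1) && (theta_label x < c.+2)%N].
Proof.
move=> f_inj; have pathE k (h : 'I_k -> theta a b c) (l : nat -> nat) u v :
    (forall i, theta_label (h i) = l i) ->
    map theta_label (u :: rcons [seq h i | i <- enum 'I_k] v) =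
    theta_label u :: rcons [seq l i | i <- iota 0 k] (theta_label v).
  move=> hl; rewrite /= map_rcons -map_comp -val_enum_ord -map_comp.
  by congr (_ :: rcons _ _); apply: eq_map.
have path_cE : c.+1 :: rcons [seq (c - i)%N | i <- iota 0 c] 0%N = rev (iota 0 c.+2).
  have -> : iota 0 c.+2 = 0%N :: rcons (iota 1 c) c.+1.
    by rewrite -[iota 0 c.+2]/(0%N :: iota 1 c.+1) -[in LHS](addn1 c) iotaD cats1 add1n.
  rewrite rev_cons rev_rcons rcons_cons; congr (_ :: rcons _ _).
  apply: (@eq_from_nth _ 0%N) => [|i]; rewrite ?size_rev ?size_map ?size_iota // => lti.
  by rewrite (nth_map 0%N) ?nth_rev ?size_iota // !nth_iota; lia.
rewrite -consecutive_rev_iota -path_cE /= /theta_arc; congr [|| _, _ | _].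
all: rewrite -(consecutive_map _ _ _ f_inj); congr (consecutive _ _ _).
- exact: pathE.
- exact: pathE.
- by apply: (@pathE c (fun i => inr (inr i)) (fun i => c - i)%N).
Qed.

Lemma theta_label_inj :
    (forall i, (i < a)%N -> (c.+1 < la i)%N) ->
    (forall i, (i < b)%N -> (c.+1 < lb i)%N) ->
    (forall i j, (i < a)%N -> (j < b)%N -> la i <> lb j) ->
    (forall i j, (i < a)%N -> (j < a)%N -> la i = la j -> i = j) ->
    (forall i j, (i < b)%N -> (j < b)%N -> lb i = lb j -> i = j) ->
  injective theta_label.
Proof.
move=> la_gt lb_gt lab la_inj lb_inj.
have ord_eq n (i j : nat) (lti : (i < n)%N) (ltj : (j < n)%N) :
  i = j -> Ordinal lti = Ordinal ltj by move=> ij; apply: val_inj.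
move=> [[]|[[[i lti]|[i lti]]|[i lti]]] [[]|[[[j ltj]|[j ltj]]|[j ltj]]] //=;
  rewrite /theta_label /= => fE;
  try (have := la_gt _ lti); try (have := la_gt _ ltj);
  try (have := lb_gt _ lti); try (have := lb_gt _ ltj);
  try (by [case: (lab _ _ lti ltj)|case: (lab _ _ ltj lti)]);
  try (by move: fE; clear; lia); try (by move: fE lti; clear; lia);
  try (by move: fE ltj; clear; lia).
- by move=> _ _; congr (inr (inl (inl _))); apply/ord_eq/la_inj.
- by move=> _ _; congr (inr (inl (inr _))); apply/ord_eq/lb_inj.
- by congr (inr (inr _)); apply/ord_eq; move: fE lti ltj; clear; lia.
Qed.
End ThetaLabel.

Lemma theta01_isomorphic (m : nat) : isomorphic (theta 0 1 m.+1) (model1 m).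
Proof.
pose f := @theta_label 0 1 m.+1 id (fun=> m.+3).
have f_inj : injective f by apply: theta_label_inj => // i j; clear; lia.
have f_lt x : (f x < m.+4)%N.
  by case: x => [[]|[[[i lti]|[i lti]]|[i lti]]]; rewrite /f /=; lia.
apply: (@isomorphic_theta _ _ _ _ _ _ f) => // x y.
apply: etrans (theta_label_arc x y f_inj) _.
rewrite -/(f x) -/(f y) /model1_arc /consecutive /= !inE !xpair_eqE.
by move: (f x) (f y) (f_lt x) => i j; clear; lia.
Qed.

Lemma theta11_isomorphic (m : nat) : isomorphic (theta 1 1 m) (model2 m).
Proof.
pose f := @theta_label 1 1 m (fun=> m.+2) (fun=> m.+3).
have f_inj : injective f by apply: theta_label_inj => // i j; clear; lia.
have f_lt x : (f x < m.+4)%N.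
  by case: x => [[]|[[[i lti]|[i lti]]|[i lti]]]; rewrite /f /=; lia.
apply: (@isomorphic_theta _ _ _ _ _ _ f) => // x y.
apply: etrans (theta_label_arc x y f_inj) _.
rewrite -/(f x) -/(f y) /model2_arc /consecutive /= !inE !xpair_eqE.
by move: (f x) (f y) (f_lt x) => i j; clear; lia.
Qed.

Lemma theta02_isomorphic (m : nat) : isomorphic (theta 0 2 m) (model3 m).
Proof.
pose f := @theta_label 0 2 m id (fun i => m.+3 - i)%N.
have f_inj : injective f by apply: theta_label_inj => // i; clear; lia.
have f_lt x : (f x < m.+4)%N.
  by case: x => [[]|[[[i lti]|[i lti]]|[i lti]]]; rewrite /f /=; lia.
apply: (@isomorphic_theta _ _ _ _ _ _ f) => // x y.
apply: etrans (theta_label_arc x y f_inj) _.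
rewrite -/(f x) -/(f y) /model3_arc /consecutive /= !inE !xpair_eqE.
by move: (f x) (f y) (f_lt x) => i j; clear; lia.
Qed.

(** * Digraphs of small spectral radius *)

Section Distance.
Variables (D : digraph) (scD : strongly_connected D).

Lemma ex_walk (x u : D) :
  exists k, [exists p : k.-tuple D, path (@darc D) x p && (last x p == u)].
Proof.
have /connectP[p pth ->] := scD x u.
by exists (size p); apply/existsP; exists (in_tuple p); rewrite pth eqxx.
Qed.

Definition dist (x u : D) : nat := ex_minn (ex_walk x u).

Lemma dist_le_path (x : D) (p : seq D) :
  path (@darc D) x p -> (dist x (last x p) <= size p)%N.
Proof.
move=> pth; rewrite /dist; case: ex_minnP => k _; apply.
by apply/existsP; exists (in_tuple p); rewrite pth eqxx.
Qed.

Lemma distP (x u : D) :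
  exists p, [/\ path (@darc D) x p, last x p = u & size p = dist x u].
Proof.
rewrite /dist; case: ex_minnP => k /existsP[p /andP[pth /eqP lastp]] _.
by exists p; split; rewrite ?size_tuple.
Qed.

Lemma distxx (x : D) : dist x x = 0%N.
Proof. by apply/eqP; rewrite -leqn0 (@dist_le_path x [::]). Qed.

Lemma dist_eq0 (x u : D) : dist x u = 0%N -> x = u.
Proof.
have [p [_ lastp sizep]] := distP x u; rewrite -sizep => /size0nil p0.
by rewrite p0 in lastp.
Qed.

Lemma dist_arc (x y : D) : darc x y -> (dist x y <= 1)%N.
Proof. by move=> xy; apply: (@dist_le_path x [:: y]); rewrite /= xy. Qed.

Lemma dist_triangle (y x z : D) : (dist x z <= dist x y + dist y z)%N.
Proof.
have [p [pth_p last_p <-]] := distP x y; have [q [pth_q last_q <-]] := distP y z.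
rewrite -size_cat -last_q -last_p -last_cat; apply: dist_le_path.
by rewrite cat_path pth_p last_p.
Qed.

Lemma dist_le_arc (x y u : D) : darc x y -> (dist x u <= (dist y u).+1)%N.
Proof.
move=> /dist_arc xy; apply: leq_trans (dist_triangle y x u) _.
by rewrite -add1n leq_add2r.
Qed.

Lemma dist_next (x u : D) : x != u -> exists2 y, darc x y & dist x u = (dist y u).+1.
Proof.
have [[|y p] /= [pth lastp sizep]] := distP x u; first by rewrite lastp eqxx.
case/andP: pth => xy pth _; exists y => //.
apply/eqP; rewrite eqn_leq dist_le_arc // -sizep ltnS -lastp.
exact: dist_le_path.
Qed.

Lemma dist_layer (x u : D) (i : nat) : (i <= dist x u)%N ->
  exists2 y, dist y u = i & (dist x y <= dist x u - i)%N.
Proof.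
move def_k: (dist x u - i)%N => k; elim: k x def_k => [|k IHk] x def_k le_i.
  by exists x; rewrite ?distxx //; lia.
have [|y xy yE] := @dist_next x u.
  by apply: contra_eq_neq def_k => ->; rewrite distxx; lia.
have [||z zE yz] := IHk y; [lia|lia|exists z => //].
have := dist_triangle y x z; have := dist_arc xy; lia.
Qed.
End Distance.

Lemma surj_nat_bij (T : finType) (n : nat) (f : T -> nat) : #|T| = n ->
    (forall i, (i < n)%N -> exists x, f x = i) ->
  exists2 g : 'I_n -> T, bijective g & forall i, f (g i) = i.
Proof.
move=> cardT surjf.
have [g gK] := fin_all_exists (fun i : 'I_n => surjf i (ltn_ord i)).
exists g => //; apply: inj_card_bij; last by rewrite cardT card_ord.
by move=> i j ij; apply: val_inj; rewrite /= -(gK i) -(gK j) ij.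
Qed.

Lemma surj_nat_inj (T : finType) (n : nat) (f : T -> nat) : #|T| = n ->
    (forall i, (i < n)%N -> exists x, f x = i) ->
  injective f /\ forall x, (f x < n)%N.
Proof.
move=> cardT surjf; have [g [h gK hK] gf] := surj_nat_bij cardT surjf.
by split=> [x y|x]; rewrite -(hK x) ?gf // -(hK y) !gf => /val_inj->.
Qed.

Lemma isomorphic_ord_digraph (D : digraph) (n : nat) (e : rel nat)
    (e_irr : irreflexive e) (f : D -> nat) :
    digraph_order D = n -> (forall i, (i < n)%N -> exists x, f x = i) ->
    (forall x y, darc x y = e (f x) (f y)) ->
  isomorphic D (ord_digraph n e_irr).
Proof.
move=> cardD surjf ef; apply: isomorphic_sym.
have [g g_bij gf] := surj_nat_bij cardD surjf.
by exists g => // i j; rewrite ef !gf.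
Qed.

Lemma dist_lt_order (D : digraph) (scD : strongly_connected D) (x u : D) :
  (dist scD x u < digraph_order D)%N.
Proof.
have layer (i : 'I_(dist scD x u).+1) : exists y, dist scD y u = i.
  by have [|y yE _] := @dist_layer D scD x u i; [rewrite -ltnS|exists y].
have [g gK] := fin_all_exists layer.
suff /leq_card : injective g by rewrite card_ord.
by move=> i j ij; apply: val_inj; rewrite /= -(gK i) -(gK j) ij.
Qed.

(** * Digraphs of radius at most that of theta(0,2,n-4) *)

Section Classification.
Variables (m : nat) (D : digraph) (t : algR).
Local Notation N := m.+3.
Hypotheses (orderD : digraph_order D = N.+1) (scD : strongly_connected D).
Hypotheses (t_gt1 : 1 < t) (t_lt2 : t < 2) (tE : t ^+ N.+1 = t ^+ 2 + 1).
Hypothesis rho_le_t : rho D <= t.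

Let t_gt0 : 0 < t. Proof. exact: lt_trans t_gt1. Qed.
Let ge1t : 1 <= t. Proof. exact: ltW. Qed.

Let sq_lt : t ^+ 2 < 2 * t. Proof. by rewrite expr2 ltr_pM2r. Qed.

Section Potential.
Variables (r : D) (g : D -> nat).
Hypotheses (gr : g r = 0%N) (g_le : forall x, (g x <= N)%N).
Hypothesis g_next : forall x, x != r -> exists2 y, darc x y & g x = (g y).+1.
Variable s : seq D.
Hypotheses (Us : uniq s) (rs : all (darc r) s).

Let y (x : D) : algR := t ^+ (N - g x).
Let y_gt0 x : 0 < y x. Proof. exact: exprn_gt0. Qed.
Let y_next x : x != r -> exists2 z, darc x z & y z = t * y x.
Proof.
move=> /g_next[z xz gx]; exists z => //; rewrite /y gx -exprS.
by congr (_ ^+ _); move: (g_le x); rewrite gx; clear; lia.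
Qed.
Let y_sub : t ^+ N.+1 <= \sum_(z <- s) y z -> forall x, t * y x <= outsum y x.
Proof.
move=> le_s x; have [->|/y_next[z xz <-]] := eqVneq x r.
  by apply: le_trans (outsum_ge y_gt0 Us rs); rewrite /y gr subn0 -exprS.
by have := @outsum_ge D y y_gt0 x [:: z]; rewrite big_seq1 /= xz; apply.
Qed.

(** With weights t^(N - g x), an arc lowering g by one already supplies t times the weight outside
    r, and at r the demand is t^(N+1). A larger sum over [s] would make t < rho. *)
Lemma potential_le : \sum_(z <- s) t ^+ (N - g z) <= t ^+ N.+1.
Proof.
rewrite leNgt; apply/negP => lt_s; move: rho_le_t; rewrite leNgt => /negP; apply.
apply: (lt_rho (x0 := r) y_gt0 scD (y_sub (ltW lt_s))).
by apply: lt_le_trans (outsum_ge y_gt0 Us rs); rewrite /y gr subn0 -exprS.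
Qed.

(** In the tight case [outsum_eq] makes the weights an eigenvector, so no arc can exist beyond those
    already counted. *)
Lemma potential_eq : \sum_(z <- s) t ^+ (N - g z) = t ^+ N.+1 ->
  (forall z, darc r z = (z \in s)) /\
  (forall x z, x != r -> darc x z -> g x = (g z).+1).
Proof.
move=> eq_s; have le_s : t ^+ N.+1 <= \sum_(z <- s) y z by rewrite eq_s.
have yE := outsum_eq y_gt0 scD (y_sub le_s) rho_le_t.
split=> [|x z /[dup] xr /g_next[z' xz' gx] xz].
  by apply: (outsum_eq_seq y_gt0 Us rs); rewrite yE /y gr subn0 -exprS.
suff: z \in [:: z'] by rewrite inE => /eqP->.
rewrite -(@outsum_eq_seq D y y_gt0 x [:: z']) //= ?xz' //.
have yz' : y z' = t * y x.
  by rewrite /y gx -exprS; congr (_ ^+ _); move: (g_le x); rewrite gx; clear; lia.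
by rewrite big_seq1 yz'; apply: yE.
Qed.
End Potential.

Let d := dist scD.
Let d_le x u : (d x u <= N)%N.
Proof. by rewrite -ltnS -orderD dist_lt_order. Qed.
Let d_sum u s : uniq s -> all (darc u) s ->
  \sum_(z <- s) t ^+ (N - d z u) <= t ^+ 2 + 1.
Proof.
move=> Us us; rewrite -tE; apply: (@potential_le u (d^~ u)) => //.
  exact: distxx.
by move=> x; apply: dist_next.
Qed.

Let t_exp k l : (k + l <= N)%N -> t ^+ l <= t ^+ (N - k).
Proof. by move=> kl; rewrite ler_weXn2l //; lia. Qed.

(** [p] and [q] only bound the exponents from below, so upper estimates of the distances suffice. *)
Lemma two_out u v w p q : darc u v -> darc u w -> v != w ->
    (d v u + p <= N)%N -> (d w u + q <= N)%N ->
  t ^+ p + t ^+ q <= t ^+ 2 + 1.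
Proof.
move=> uv uw vw /t_exp le_p /t_exp le_q; apply: le_trans (@d_sum u [:: v; w] _ _).
- by rewrite big_cons big_seq1 lerD.
- by rewrite /= inE vw.
- by rewrite /= uv uw.
Qed.

Lemma three_out u v w x p q k : darc u v -> darc u w -> darc u x ->
    uniq [:: v; w; x] ->
    (d v u + p <= N)%N -> (d w u + q <= N)%N -> (d x u + k <= N)%N ->
  t ^+ p + (t ^+ q + t ^+ k) <= t ^+ 2 + 1.
Proof.
move=> uv uw ux U /t_exp le_p /t_exp le_q /t_exp le_k.
apply: le_trans (@d_sum u [:: v; w; x] _ _) => //.
  by rewrite !big_cons big_nil addr0 !lerD.
by rewrite /= uv uw ux.
Qed.

(* Raising the weight of [v] from [t] to [(t ^+ 2 + t) / t] makes the weight   *)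
(* vector subinvariant with a strict inequality at [r], since [2 * t > t ^+ 2]. *)
Lemma no_triangle (g : D -> nat) (r v w s : D) : g r = 0%N ->
    (forall x, x != r -> x != v -> exists2 y, darc x y & g x = (g y).+1) ->
    (forall x, (g x <= N)%N) -> g w = m.+2 -> g v = m.+2 -> g s = m.+1 ->
    darc r v -> darc r w -> darc v w -> darc v s -> False.
Proof.
move=> gr g_next g_le gw gv gs rv rw vw vs.
pose y x : algR := if x == v then 1 + t else t ^+ (N - g x).
have vr : r != v by apply: contra_eq_neq gv => <-; rewrite gr.
have wv : w != v by apply: contraTneq vw => ->; rewrite darc_irr.
have ws : w != s by apply: contra_eq_neq gw => ->; rewrite gs ltn_eqF.
have sv : s != v by apply: contraTneq vs => ->; rewrite darc_irr.
have y_gt0 x : 0 < y x.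
  by rewrite /y; case: eqP => // _; rewrite ?exprn_gt0 // addr_gt0.
have yv : y v = 1 + t by rewrite /y eqxx.
have yw : y w = t by rewrite /y (negPf wv) gw subSnn.
have ys : y s = t ^+ 2.
  by rewrite /y (negPf sv) gs; congr (_ ^+ _); clear; lia.
have y_ge x : t ^+ (N - g x) <= y x.
  rewrite /y; case: eqP => // ->; rewrite gv subSnn; lra.
have yr : t * y r < outsum y r.
  apply: lt_le_trans (@outsum_ge D y y_gt0 r [:: v; w] _ _).
  - rewrite big_cons big_seq1 yv yw /y (negPf vr) gr subn0 -exprS tE.
    by have := sq_lt; lra.
  - by rewrite /= inE eq_sym wv.
  - by rewrite /= rv rw.
have y_sub x : t * y x <= outsum y x.
  have [->|xr] := eqVneq x r; first exact: ltW.
  have [->|xv] := eqVneq x v.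
    apply: le_trans (@outsum_ge D y y_gt0 v [:: w; s] _ _).
    - by rewrite big_cons big_seq1 yv yw ys; lra.
    - by rewrite /= inE ws.
    - by rewrite /= vw vs.
  have [z xz gx] := g_next x xr xv.
  apply: le_trans (@outsum_ge D y y_gt0 x [:: z] _ _) => //=; last by rewrite xz.
  rewrite big_seq1; apply: le_trans (y_ge z).
  rewrite /y (negPf xv) -exprS gx ler_weXn2l //.
  by move: (g_le x); rewrite gx; clear; lia.
by have := lt_le_trans (lt_rho y_gt0 scD y_sub yr) rho_le_t; rewrite ltxx.
Qed.

Lemma two_out_cases u v w : darc u v -> darc u w -> v != w ->
    (d v u <= d w u)%N ->
  [\/ d v u = m.+1 /\ d w u = N, d v u = m.+2 /\ d w u = N
    | d v u = m.+2 /\ d w u = m.+2].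
Proof.
move=> uv uw vw le_vw.
(* Distance at most N - 3 would give t^3 + 1 > t^2 + 1. *)
have lt_v : (m < d v u)%N.
  rewrite ltnNge; apply/negP => le_v.
  have := @two_out u v w 3 0 uv uw vw; rewrite addn0 d_le expr0 => /(_ _ isT).
  have -> : (d v u + 3 <= N)%N by rewrite addn3 !ltnS.
  move=> /(_ isT); have : t ^+ 2 < t ^+ 3 by rewrite ltr_eXn2l.
  by lra.
(* A vertex at distance N makes the n vertices take each of the distances 0, ..., N exactly once. *)
have nN : d w u = N -> d v u != N.
  move=> wN; have [||f_inj _] := @surj_nat_inj D N.+1 (d^~ u) => //.
    move=> i ltiN; have [|x xE _] := @dist_layer D scD w u i; last by exists x.
    by rewrite -/d wN.
  by apply: contraNneq vw => vN; apply/eqP/f_inj; rewrite vN.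
(* Here the bound fails because t^2 + t > t^2 + 1. *)
have n21 : ~ ((d v u <= m.+1)%N /\ (d w u <= m.+2)%N).
  case=> le_v le_w; have := @two_out u v w 2 1 uv uw vw.
  have -> : (d v u + 2 <= N)%N by rewrite addn2 !ltnS.
  have -> : (d w u + 1 <= N)%N by rewrite addn1 !ltnS.
  by rewrite expr1 => /(_ isT isT); have := t_gt1; lra.
move: (d_le w u) (d_le v u) lt_v le_vw nN n21; clear.
have [-> _ le_v lt_v _ /(_ erefl) vN _|wN] := eqVneq (d w u) N.
  by have [vN1|vN1] := eqVneq (d v u) m.+1; [constructor 1|constructor 2]; lia.
by constructor 3; lia.
Qed.

Let next_arc u x y :
  (forall z, d z u = d y u -> z = y) -> d x u = (d y u).+1 -> darc x y.
Proof.
move=> uniq_y xy; have [|z xz] := @dist_next D scD x u.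
  by apply: contra_eq_neq xy => ->; rewrite /d distxx.
by rewrite -/d xy => -[/esym/uniq_y <-].
Qed.

Let dist_layer_le u x y : (forall z, d z u = d x u -> z = x) ->
  (d x u <= d y u)%N -> (d y x <= d y u - d x u)%N.
Proof. by move=> uniq_x /dist_layer[z /uniq_x ->]. Qed.

(** From z go to u in d x u - 1 steps, take the arc to v, then reach x in d v u - d x u steps, since
    x is alone at its distance. *)
Let dist_through u v x z : darc u v -> (forall w, d w u = d x u -> w = x) ->
  (d x u <= d v u)%N -> d x u = (d z u).+1 -> (d z x <= d v u)%N.
Proof.
move=> uv uniq_x le_xv xz.
have := dist_layer_le uniq_x le_xv; have := dist_arc scD uv; rewrite -/d.
have := dist_triangle scD u z x; have := dist_triangle scD v u x.
move: le_xv xz; rewrite /d; clear; lia.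
Qed.

(** The distances N - 2 and N give exactly t^2 + 1 = t^(N+1), so [potential_eq] determines all arcs
    at once. *)
Lemma isomorphic_model3 u v w : darc u v -> darc u w ->
  d v u = m.+1 -> d w u = N -> isomorphic D (model3 m).
Proof.
move=> uv uw dv dw.
have surj i : (i < N.+1)%N -> exists x, d x u = i.
  by rewrite ltnS -dw => /dist_layer[x xE _]; exists x.
have [d_inj _] := surj_nat_inj orderD surj.
have vw : v != w by apply: contra_eq_neq dv => ->; rewrite dw gtn_eqF.
have [||||||ur down] := @potential_eq u (d^~ u) _ _ _ [:: v; w].
- exact: distxx.
- by move=> x; apply: d_le.
- by move=> x; apply: dist_next.
- by rewrite /= inE vw.
- by rewrite /= uv uw.
- rewrite big_cons big_seq1 dv dw subnn tE; congr (_ ^+ _ + _); clear; lia.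
apply: isomorphic_ord_digraph (orderD) (surj) _ => x y.
have [->|xu] := eqVneq x u.
  rewrite ur !inE -!(inj_eq d_inj) dv dw /d distxx /model3_arc orbC.
  by congr (_ || _); rewrite eqxx /= eqSS.
have dx : d x u != 0%N by apply: contraNneq xu => /dist_eq0 ->.
rewrite /model3_arc (negPf dx) /= orbF; apply/idP/eqP => [/down-> //|].
by apply: next_arc => z /d_inj.
Qed.

Lemma isomorphic_model1 u v w : darc u v -> darc u w ->
  d v u = m.+2 -> d w u = N -> isomorphic D (model1 m).
Proof.
move=> uv uw dv dw.
have surj i : (i < N.+1)%N -> exists x, d x u = i.
  by rewrite ltnS -dw => /dist_layer[x xE _]; exists x.
have [d_inj _] := surj_nat_inj orderD surj.
have vw : v != w by apply: contra_eq_neq dv => ->; rewrite dw gtn_eqF.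
apply: isomorphic_ord_digraph (orderD) (surj) _ => x y.
have du : d u u = 0%N by apply: distxx.
apply/idP/idP => [xy|]; last first.
  case/orP=> [/eqP|/andP[/eqP/dist_eq0-> /orP[/eqP dy|/eqP[dy]]]].
  - by apply: next_arc => z /d_inj.
  - by have -> : y = w by apply: d_inj; rewrite dw.
  - by have -> : y = v by apply: d_inj; rewrite dv.
(* The arcs of the model are all present. Suppose that x -> y is a further arc; it cannot decrease
   the distance to u. *)
apply/negPn/negP; rewrite /model1_arc negb_or => /andP[xy_down xy_top].
have le_xy : (d x u <= d y u)%N.
  have := dist_le_arc scD u xy; rewrite -/d leq_eqVlt (negPf xy_down).
  by rewrite ltnS.
have [xu|xu] := eqVneq x u.
  rewrite xu du eqxx /= in xy_top xy.
  (* A third out-neighbour of u at distance at most N - 2 would give t + 1 + t^2 > t^2 + 1. *)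
  have dy : (d y u + 2 <= N)%N.
    move: (d_le y u) xy_top; clear; lia.
  have := @three_out u v w y 1 0 2 uv uw xy; rewrite dv dw dy addn1 addn0 !leqnn.
  rewrite /= !inE negb_or vw /= -!(inj_eq d_inj) /= dv dw.
  have -> : m.+2 == d y u = false by move: dy; clear; lia.
  have -> : N == d y u = false by move: dy; clear; lia.
  by move=> /(_ isT isT isT isT); rewrite expr0 expr1; have := t_gt1; lra.
have dx : (0 < d x u)%N by rewrite lt0n; apply: contraNneq xu => /dist_eq0 ->.
have neq_xy : y != x by apply: contraTneq xy => ->; rewrite darc_irr.
have lt_xy : (d x u < d y u)%N.
  by rewrite ltn_neqAle le_xy andbT (inj_eq d_inj) eq_sym.
have [z xz dz] := @dist_next D scD x u xu; rewrite -/d in dz.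
have neq_yz : y != z by apply: contraTneq lt_xy => ->; rewrite -leqNgt dz.
have uniq_x z' : d z' u = d x u -> z' = x by move/d_inj.
have le_yx := dist_layer_le uniq_x le_xy.
have le_xv : (d x u <= d v u)%N.
  by rewrite dv -ltnS; apply: leq_trans lt_xy _; apply: d_le.
have le_zx := dist_through uv uniq_x le_xv dz; rewrite dv in le_zx.
(* Now take distances to x: z is within N - 1, so y within N - 2 would give t^2 + t. The only escape
   is that x is the vertex just before u and y = w. *)
have [short|long] := leqP (d y x + 2) N.
  have := two_out xy xz neq_yz short (q := 1); rewrite addn1 ltnS le_zx.
  by move=> /(_ isT); rewrite expr1; have := t_gt1; lra.
have [dx1 dyN] : d x u = 1%N /\ d y u = N.
  move: long le_yx dx (d_le y u) lt_xy; clear; lia.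
have yw : y = w by apply: d_inj; rewrite dyN dw.
have zu : z = u by apply: dist_eq0; apply: succn_inj; rewrite -dz dx1.
subst y z.
(* Distances rerooted at x: u gets N - 1, the length of its route through v, and every other vertex
   loses the last step from x to u. The raised vertex of [no_triangle] is u. *)
pose g z := if z == u then m.+2 else (d z u).-1.
have gE z : z != u -> g z = (d z u).-1 by rewrite /g => /negPf->.
have neq_u z : d z u != 0%N -> z != u by apply: contra_neq => ->.
apply: (@no_triangle g x u w v) => //.
- by rewrite gE // dx1.
- move=> z zx zu; have [z' zz' dz'] := @dist_next D scD z u zu; rewrite -/d in dz'.
  exists z' => //; rewrite gE // dz' gE.
    rewrite /= prednK // lt0n; apply: contra_neq zx => dz'0.
    by apply: d_inj; rewrite /= dz' dz'0 dx1.
  by apply: contra_neq zx => z'u; apply: d_inj; rewrite /= dz' z'u dx1 du.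
- by move=> z; rewrite /g; case: eqP => // _; have := d_le z u; clear; lia.
- by rewrite gE ?dw // neq_u ?dw.
- by rewrite /g eqxx.
- by rewrite gE ?dv // neq_u ?dv.
Qed.

Lemma isomorphic_model2 u v w : darc u v -> darc u w -> v != w ->
  d v u = m.+2 -> d w u = m.+2 -> isomorphic D (model2 m).
Proof.
move=> uv uw vw dv dw.
(* Both v and w are at distance N - 1; moving w to N breaks the tie and makes the labels exhaust 0,
   ..., N. *)
pose lab x := if x == w then N else d x u.
have labw : lab w = N by rewrite /lab eqxx.
have labE x : x != w -> lab x = d x u by rewrite /lab => /negPf->.
have surj i : (i < N.+1)%N -> exists x, lab x = i.
  rewrite ltnS leq_eqVlt => /predU1P[->|]; first by exists w.
  rewrite ltnS -dv leq_eqVlt => /predU1P[->|lt_i]; first by exists v; rewrite labE.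
  have [x xE _] := dist_layer (ltnW lt_i); exists x; rewrite labE //.
  by apply: contraTneq lt_i => xw; rewrite -xE xw -/d dw dv ltnn.
have [lab_inj _] := surj_nat_inj orderD surj.
have du : d u u = 0%N by apply: distxx.
have uNw : u != w by apply: contra_eq_neq dw => <-; rewrite du.
have d_le2 x : (d x u <= m.+2)%N.
  rewrite leqNgt; apply/negP => lt_x.
  have dx : d x u = N by apply/eqP; rewrite eqn_leq d_le.
  have xw : x != w by apply: contraTneq lt_x => ->; rewrite dw ltnn.
  by case/eqP: (xw); apply: lab_inj; rewrite labw labE.
have uniq_d x : (d x u <= m.+1)%N -> forall y, d y u = d x u -> y = x.
  move=> le_x y yx; have neq_w z : (d z u <= m.+1)%N -> z != w.
    by apply: contraTneq => ->; rewrite dw ltnn.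
  by apply: lab_inj; rewrite !labE ?neq_w // yx.
have top x : d x u = m.+2 -> (x == v) || (x == w).
  move=> dx; have [//|xw] := eqVneq x w; rewrite ?orbT // orbF.
  by apply/eqP/lab_inj; rewrite !labE // dx dv.
have u_arc x : d x u = m.+2 -> darc u x by move=> /top /orP[]/eqP->.
apply: isomorphic_ord_digraph (orderD) (surj) _ => x y.
apply/idP/idP => [xy|]; last first.
  case/or3P=> [/andP[/eqP xy ltxN]|/andP[/eqP xN /eqP yN]|/andP[/eqP x0 /orP[]/eqP yN]].
  - have xw : x != w by apply: contraTneq ltxN => ->; rewrite labw ltnn.
    have yw : y != w by apply: contraTneq ltxN => yw; rewrite xy yw labw -leqNgt.
    rewrite !labE // in xy; apply: next_arc (xy); apply: uniq_d.
    by rewrite -ltnS -xy.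
  - have xw : x = w by apply: lab_inj; rewrite labw.
    have yw : y != w by apply: contra_eq_neq yN => ->; rewrite labw gtn_eqF.
    have dy : d y u = m.+1 by rewrite -labE //; case: yN.
    by rewrite xw; apply: next_arc; [apply: uniq_d; rewrite dy|rewrite dw dy].
  - have -> : x = u by apply: lab_inj; rewrite x0 labE.
    by have -> : y = w by apply: lab_inj; rewrite labw.
  - have -> : x = u by apply: lab_inj; rewrite x0 labE.
    by have -> : y = v by apply: lab_inj; rewrite (labE v) // dv; case: yN.
have le_dxy : (d x u <= (d y u).+1)%N := dist_le_arc scD u xy.
have [dxy|ndxy] := eqVneq (d x u) (d y u).+1.
  have yw : y != w.
    by apply: contraTneq (d_le2 x) => yw; rewrite dxy yw dw ltnn.
  rewrite /model2_arc (labE y) //; have [xw|xw] := eqVneq x w.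
    by rewrite xw labw -dxy xw dw !eqxx orbT.
  by rewrite labE // dxy eqxx /= -dxy ltnS d_le2.
have {le_dxy ndxy} le_xy : (d x u <= d y u)%N.
  by rewrite leq_eqVlt in le_dxy; move: le_dxy; rewrite (negPf ndxy).
have [xu|xu] := eqVneq x u.
  rewrite xu in xy *; rewrite /model2_arc (labE u) // du.
  suff : d y u = m.+2.
    move=> dy; case/orP: (top y dy) => /eqP->.
      by rewrite (labE v) // dv !eqxx !orbT.
    by rewrite labw !eqxx !orbT.
  (* A third out-neighbour of u at distance at most N - 2 would give t + t + t^2 > t^2 + 1. *)
  apply/eqP; rewrite eqn_leq d_le2 /= ltnNge; apply/negP => dy.
  have := @three_out u v w y 1 1 2 uv uw xy; rewrite dv dw !addn1 addn2 !leqnn !ltnS dy.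
  rewrite /= !inE negb_or vw /=.
  have -> : v != y by apply: contraTneq dy => <-; rewrite dv ltnn.
  have -> : w != y by apply: contraTneq dy => <-; rewrite dw ltnn.
  by move=> /(_ isT isT isT isT); rewrite expr1; have := t_gt1; lra.
exfalso.
have dx : (0 < d x u)%N by rewrite lt0n; apply: contraNneq xu => /dist_eq0 ->.
have neq_xy : y != x by apply: contraTneq xy => ->; rewrite darc_irr.
have [z xz dz] := @dist_next D scD x u xu; rewrite -/d in dz.
have neq_yz : y != z by apply: contraTneq le_xy => ->; rewrite -ltnNge dz.
(* Below the top distance x is alone in its layer, so relative to x the two out-neighbours are
   within N - 2 and N - 1, giving t^2 + t. *)
have [dx1|dx2] := leqP (d x u) m.+1.
  have uniq_x := uniq_d x dx1.
  have le_xv : (d x u <= d v u)%N by rewrite dv (leq_trans dx1).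
  have le_zx := dist_through uv uniq_x le_xv dz; rewrite dv in le_zx.
  have le_yx := dist_layer_le uniq_x le_xy.
  have := @two_out x y z 2 1 xy xz neq_yz; rewrite addn1 addn2 !ltnS le_zx.
  have -> : (d y x <= m.+1)%N.
    move: le_yx dx (d_le2 y); clear; lia.
  by move=> /(_ isT isT); rewrite expr1; have := t_gt1; lra.
have dxE : d x u = m.+2 by apply/eqP; rewrite eqn_leq d_le2.
have dyE : d y u = m.+2 by apply/eqP; rewrite eqn_leq d_le2 -dxE.
have dzE : d z u = m.+1 by apply/eqP; rewrite -eqSS -dz dxE.
(* What remains is an arc between the two vertices at distance N - 1, both out-neighbours of u. *)
apply: (@no_triangle (d^~ u) u x y z) => //; try exact: u_arc.
by move=> x' x'u _; apply: dist_next.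
Qed.

Lemma classification : [\/ rho D = 1, isomorphic D (model1 m),
  isomorphic D (model2 m) | isomorphic D (model3 m)].
Proof.
have [|out1] := boolP [exists u, exists v, exists w,
    [&& darc u v, darc u w & v != w :> D]].
  move=> /existsP[u /existsP[v /existsP[w /and3P[uv uw vw]]]].
  wlog le_vw : v w uv uw vw / (d v u <= d w u)%N.
    move=> hwlog; case/orP: (leq_total (d v u) (d w u)); apply: hwlog => //.
    by rewrite eq_sym.
  case: (two_out_cases uv uw vw le_vw) => -[dv dw].
  - by constructor 4; apply: isomorphic_model3 uv uw dv dw.
  - by constructor 2; apply: isomorphic_model1 uv uw dv dw.
  - by constructor 3; apply: isomorphic_model2 uv uw vw dv dw.
constructor 1.
have card_gt1 : (1 < #|D|)%N by rewrite [X in (1 < X)%N]orderD.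
have /card_gt1P[a [b [_ _ ab]]] := card_gt1.
have out (x : D) : exists y, darc x y.
  have [u xu] : exists u, x != u.
    by have [->|xa] := eqVneq x a; [exists b|exists a].
  by have [y xy _] := dist_next scD xu; exists y.
have [g xg] := fin_all_exists out.
apply: (outdeg1_rho a (g := g)) => // x z; apply/idP/eqP => [xz|->//].
apply: contraNeq out1 => zg; apply/existsP; exists x.
by apply/existsP; exists z; apply/existsP; exists (g x); rewrite xz xg.
Qed.
End Classification.

(** * Ranking of the spectral radii *)

(** If r < r', then r and everything below r lie below r', so the two counts differ. Realness makes
    r and r' comparable, as the order of [algC] is partial. *)
Lemma kth_min_uniq (S : algC -> Prop) (k : nat) (r r' : algC) :
    (forall s, S s -> s \is Creal) -> kth_min S k r -> kth_min S k r' -> r = r'.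
Proof.
move=> S_real; wlog lt_rr' : r r' / r < r'.
  move=> hwlog hr hr'; have [lt|gt|//] := real_ltgtP (S_real r hr.1) (S_real r' hr'.1).
    exact: hwlog.
  exact/esym/hwlog.
case=> Sr [l [Ul sl lP]] [Sr' [l' [Ul' sl' l'P]]].
have : (size (r :: l) <= size l')%N.
  apply: uniq_leq_size.
    by rewrite /= Ul andbT; apply/negP => /lP[_]; rewrite ltxx.
  move=> s; rewrite inE => /predU1P[->|/lP[Ss ltsr]]; apply/l'P => //.
  by split=> //; apply: lt_trans lt_rr'.
by rewrite /= -ltnS sl sl' ltnn.
Qed.

Lemma strong_spectral_radiiP (n : nat) (t : algR) (D : digraph) :
  digraph_order D = n -> strongly_connected D -> rho D = t ->
  strong_spectral_radii n (algRval t).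
Proof. by move=> orderD scD <-; exists D. Qed.

(** The trichotomy shows that [l] contains every smaller radius; for a digraph of equal radius it
    leaves only the isomorphism with [M]. *)
Lemma unique_kth_min_digraph_iso (n : nat) (D M : digraph) (l : seq algR) :
    isomorphic D M -> digraph_order M = n -> strongly_connected M ->
    uniq l -> {in l, forall t, t < rho D} ->
    {in l, forall t, exists E,
      [/\ digraph_order E = n, strongly_connected E & rho E = t]} ->
    (forall E, digraph_order E = n -> strongly_connected E ->
       [\/ rho E \in l, isomorphic E M | rho D < rho E]) ->
    (forall E, isomorphic E M -> rho E = rho D) ->
  unique_kth_min_digraph n (size l).+1 D.
Proof.
move=> isoDM orderM scM Ul l_lt l_real cases iso_rho.
have orderD : digraph_order D = n by rewrite (isomorphic_order isoDM).
have scD := isomorphic_strongly_connected (isomorphic_sym isoDM) scM.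
have kthD : kth_min (strong_spectral_radii n) (size l).+1 (spectral_radius D).
  split; first by exists D.
  exists (map algRval l); split=> [|| s].
  - by rewrite map_inj_uniq //; apply: val_inj.
  - by rewrite size_map.
  split=> [/mapP[t lt ->]|[[E [orderE scE <-]] ltED]].
    have [E [orderE scE rhoE]] := l_real t lt.
    split; first exact: strong_spectral_radiiP orderE scE rhoE.
    exact: l_lt.
  have {}ltED : rho E < rho D by [].
  case: (cases E orderE scE) => [lE|/iso_rho EM|ltDE].
  - by apply/mapP; exists (rho E).
  - by rewrite EM ltxx in ltED.
  - by have := lt_trans ltED ltDE; rewrite ltxx.
split=> // E orderE scE kthE.
have rhoED : rho E = rho D.
  apply: val_inj; apply: kth_min_uniq kthE kthD => s [F [_ _ <-]].
  exact: spectral_radius_real.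
case: (cases E orderE scE) => [lE|isoEM|].
- by have := l_lt _ lE; rewrite rhoED ltxx.
- exact: isomorphic_trans isoEM (isomorphic_sym isoDM).
- by rewrite rhoED ltxx.
Qed.

Lemma theta_unique_kth_min_digraph (m : nat) :
  [/\ unique_kth_min_digraph m.+4 2 (theta 0 1 m.+1),
      unique_kth_min_digraph m.+4 3 (theta 1 1 m)
    & unique_kth_min_digraph m.+4 4 (theta 0 2 m)].
Proof.
have [[[t1 t2] t3] /= [t1E t2E t3E [t1_gt1 t12 t23 t3_lt2]]] := model_radii m.
have t13 := lt_trans t12 t23.
have [t2_gt1 t3_gt1] : 1 < t2 /\ 1 < t3 by split; apply: lt_trans t1_gt1 _.
have rho1 E : isomorphic E (model1 m) -> rho E = t1 by apply: model1_rho.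
have rho2 E : isomorphic E (model2 m) -> rho E = t2 by apply: model2_rho.
have rho3 E : isomorphic E (model3 m) -> rho E = t3 by apply: model3_rho.
have iso1 := theta01_isomorphic m; have iso2 := theta11_isomorphic m.
have iso3 := theta02_isomorphic m.
(* Digraphs of radius above [t3] never affect the first four ranks, so [classification] is needed
   only up to [t3]. *)
have cases E : digraph_order E = m.+4 -> strongly_connected E ->
    [\/ t3 < rho E, rho E = 1 | [\/ isomorphic E (model1 m),
      isomorphic E (model2 m) | isomorphic E (model3 m)]].
  move=> orderE scE; have [le_t3|] := leP (rho E) t3; last by constructor 1.
  case: (classification orderE scE t3_gt1 t3_lt2 t3E le_t3).
  - by constructor 2.
  - by constructor 3; constructor 1.
  - by constructor 3; constructor 2.
  - by constructor 3; constructor 3.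
have order_ord e e_irr : digraph_order (@ord_digraph m.+4 e e_irr) = m.+4.
  exact: card_ord.
have attained1 : exists E, [/\ digraph_order E = m.+4, strongly_connected E & rho E = 1].
  exists (cycle_digraph m); split; first exact: order_ord.
    exact: cycle_strongly_connected.
  exact: cycle_rho.
have attained2 : exists E, [/\ digraph_order E = m.+4, strongly_connected E & rho E = t1].
  exists (model1 m); split; [exact: order_ord|exact: model1_strongly_connected|].
  by apply: rho1; exists id; first by exists id.
have attained3 : exists E, [/\ digraph_order E = m.+4, strongly_connected E & rho E = t2].
  exists (model2 m); split; [exact: order_ord|exact: model2_strongly_connected|].
  by apply: rho2; exists id; first by exists id.
split.
- apply: (@unique_kth_min_digraph_iso _ _ (model1 m) [:: 1]) => //.
  + exact: order_ord.
  + exact: model1_strongly_connected.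
  + by move=> t; rewrite inE => /eqP->; rewrite rho1.
  + by move=> t; rewrite inE => /eqP->.
  + move=> E orderE scE; rewrite (rho1 _ iso1) inE.
    case: (cases E orderE scE) => [/(lt_trans t13)|->|[isoE|/rho2->|/rho3->]].
    * by constructor 3.
    * by constructor 1.
    * by constructor 2.
    * by constructor 3.
    * by constructor 3.
  + by move=> E /rho1->; rewrite rho1.
- apply: (@unique_kth_min_digraph_iso _ _ (model2 m) [:: 1; t1]) => //.
  + exact: order_ord.
  + exact: model2_strongly_connected.
  + by rewrite /= inE lt_eqF.
  + by move=> t; rewrite !inE (rho2 _ iso2) => /orP[]/eqP->.
  + by move=> t; rewrite !inE => /orP[]/eqP->.
  + move=> E orderE scE; rewrite (rho2 _ iso2) !inE.
    case: (cases E orderE scE) => [/(lt_trans t23)|->|[/rho1->|isoE|/rho3->]].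
    * by constructor 3.
    * by constructor 1; rewrite eqxx.
    * by constructor 1; rewrite eqxx orbT.
    * by constructor 2.
    * by constructor 3.
  + by move=> E /rho2->; rewrite rho2.
- apply: (@unique_kth_min_digraph_iso _ _ (model3 m) [:: 1; t1; t2]) => //.
  + exact: order_ord.
  + exact: model3_strongly_connected.
  + by rewrite /= !inE !lt_eqF.
  + by move=> t; rewrite !inE (rho3 _ iso3) => /or3P[]/eqP->.
  + by move=> t; rewrite !inE => /or3P[]/eqP->.
  + move=> E orderE scE; rewrite (rho3 _ iso3) !inE.
    case: (cases E orderE scE) => [|->|[/rho1->|/rho2->|isoE]].
    * by constructor 3.
    * by constructor 1; rewrite eqxx.
    * by constructor 1; rewrite eqxx orbT.
    * by constructor 1; rewrite eqxx !orbT.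
    * by constructor 2.
  + by move=> E /rho3->; rewrite rho3.
Qed.

Local Close Scope ring_scope.

Theorem theorem3 (n : nat) (hn : 4 <= n) :
  [/\ unique_kth_min_digraph n 2 (theta 0 1 (n - 3)),
      unique_kth_min_digraph n 3 (theta 1 1 (n - 4))
    & unique_kth_min_digraph n 4 (theta 0 2 (n - 4))].
Proof.
case: n hn => [|[|[|[|m]]]] // _; rewrite !subSS !subn0.
exact: theta_unique_kth_min_digraph.
Qed.
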